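(* Let $k$ be an infinite field and let $G$ be a connected graph on the vertices $x_1,\ldots,x_s$ containing a unique cycle, which is of even length $d\ge 4$ and has edges $e_i=x_ix_{i+1}$ for $1\le i<d$ and $e_d=x_1x_d$. Assume further that $x_j$ is a leaf for all $j>d$, so that for each $j>d$ there is a unique vertex $x_{i_j}$ with $1\le i_j\le d$ such that $e_j=x_{i_j}x_j$ is an edge of $G$ (the $i_j$ need not be distinct, and $s=d$ is allowed). Let $R=k[x_1,\ldots,x_s]_{(x_1,\ldots,x_s)}$, let $\mathfrak{m}$ be its maximal ideal, and let $I=(e_1,\ldots,e_s)\subset R$ be the edge ideal of $G$. If $J$ is a minimal reduction of $I$, then $J:I=\mathfrak{m}$.
   Context: Edges are identified with the corresponding monomials $x_ix_j\in R$, and the edge ideal is generated by these monomials. A reduction of an ideal $I$ is an ideal $J\subset I$ with $I^{r+1}=JI^r$ for some integer $r\ge 0$; a minimal reduction is a reduction that is minimal with respect to inclusion among reductions of $I$. *)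

(* Defs.v *)
From HB Require Import structures.
From mathcomp Require Import all_boot all_order all_algebra.
From mathcomp Require Import mpoly boolp classical_sets cardinality.

Set Implicit Arguments.
Unset Strict Implicit.
Unset Printing Implicit Defensive.

Import GRing.Theory.

Section Graphs.
Variable T : finType.
Implicit Types (e : rel T) (c : seq T).

Definition simple_graph e := ssrbool.symmetric e /\ irreflexive e.

Definition connected_graph e := forall x y : T, connect e x y.

Definition graph_cycle e c := ucycle e c /\ 2 < size c.

(* Two vertex sequences describe the same cycle, up to rotation and reversal,
   exactly when they traverse the same set of edges. *)
Definition cycle_edges c : {set {set T}} :=
  [set [set x; next c x] | x in c].

Definition unique_cycle e c :=
  graph_cycle e c /\
  forall c', graph_cycle e c' -> cycle_edges c' = cycle_edges c.

Definition leaf e x := #|[set y | e x y]| = 1.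

End Graphs.

Local Open Scope classical_set_scope.
Local Open Scope ring_scope.

Section Ideals.
Variable R : comNzRingType.
Implicit Types (A I J : set R).

Definition is_ideal I :=
  [/\ I 0, forall x y, I x -> I y -> I (x + y) & forall a x, I x -> I (a * x)].

Definition ideal_gen A : set R :=
  [set x | forall I, is_ideal I -> A `<=` I -> I x].

Definition ideal_mul I J : set R :=
  ideal_gen [set z | exists x y, [/\ I x, J y & z = x * y]].

Definition ideal_exp I (n : nat) : set R := iter n (ideal_mul I) setT.

Definition ideal_colon J I : set R := [set a | forall x, I x -> J (a * x)].

Definition maximal_ideal I :=
  [/\ is_ideal I, ~ I 1 &
      forall I', is_ideal I' -> ~ I' 1 -> I `<=` I' -> I' = I].

Definition reduction I J :=
  [/\ is_ideal J, J `<=` I &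
      exists r : nat, ideal_exp I r.+1 = ideal_mul J (ideal_exp I r)].

Definition minimal_reduction I J :=
  reduction I J /\ forall J', reduction I J' -> J' `<=` J -> J' = J.

Lemma ideal_gen_ideal A : is_ideal (ideal_gen A).
Proof.
split=> [I [] //|x y Ax Ay I idI AI|a x Ax I idI AI]; case: (idI) => _ ID IM.
- by apply: ID; [apply: Ax | apply: Ay].
- by apply: IM; apply: Ax.
Qed.

Lemma ideal_gen_sub A : A `<=` ideal_gen A.
Proof. by move=> x Ax I _; apply. Qed.

End Ideals.

Section Localization.
Variables (k : fieldType) (n : nat).

Definition origin_ideal : set {mpoly k[n]} :=
  ideal_gen [set p | exists i : 'I_n, p = 'X_i].

Lemma const_coefM (p q : {mpoly k[n]}) : (p * q)@_0%MM = p@_0%MM * q@_0%MM.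
Proof. exact: rmorphM. Qed.

Lemma origin_idealE (p : {mpoly k[n]}) : origin_ideal p <-> p@_0%MM = 0.
Proof.
split.
  move/(_ [set q | q@_0%MM = 0]); apply=> [|q [i ->]] /=; last first.
    by rewrite mcoeffX mnm1_eq0.
  split=> /= [|x y x0 y0|a x x0]; first by rewrite mcoeff0.
    by rewrite mcoeffD x0 y0 addr0.
  by rewrite const_coefM x0 mulr0.
move=> p0; rewrite [p]mpolyE /=.
have [I0 ID IM] := ideal_gen_ideal [set q : {mpoly k[n]} | exists i, q = 'X_i].
rewrite -/origin_ideal in I0 ID IM.
rewrite big_seq; elim/big_ind: _ => // m mp.
have : m != 0%MM.
  by apply/eqP=> m0; move: mp; rewrite mcoeff_msupp m0 p0 eqxx.
rewrite -mdeg_eq0 mdegE sum_nat_eq0 negb_forall => /existsP[i] /= mi.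
have -> : m = (m - U_(i) + U_(i))%MM.
  rewrite submK //; apply/mnm_lepP=> j; rewrite mnm1E.
  by case: eqP => // <-; rewrite lt0n.
rewrite -mul_mpolyC mpolyXD mulrA; apply: IM.
by apply: ideal_gen_sub; exists i.
Qed.

Lemma origin_idealP (p : {mpoly k[n]}) : ~ origin_ideal p <-> p@_0%MM != 0.
Proof.
by split=> [h|/eqP h]; [apply/eqP|]; rewrite -?origin_idealE // origin_idealE.
Qed.

(* The local ring k[x_1, ..., x_n]_(x_1, ..., x_n), realised inside the field of
   fractions k(x_1, ..., x_n). *)
Definition local_frac : {pred {fraction {mpoly k[n]}}} :=
  fun f => `[< exists p q : {mpoly k[n]},
                 ~ origin_ideal q /\ f = tofrac p / tofrac q >].

Lemma local_fracP f :
  reflect (exists p q : {mpoly k[n]}, q@_0%MM != 0 /\ f = tofrac p / tofrac q)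
          (f \in local_frac).
Proof.
apply: (iffP (asboolP _)) => -[p [q [q0 ->]]]; exists p, q; split=> //.
- exact/origin_idealP.
- exact/origin_idealP.
Qed.

Lemma tofrac_neq0 (q : {mpoly k[n]}) :
  q@_0%MM != 0 -> tofrac q != 0 :> {fraction {mpoly k[n]}}.
Proof.
by move=> q0; rewrite tofrac_eq0; apply: contraNneq q0 => ->; rewrite mcoeff0.
Qed.

Lemma local_frac_subring : subring_closed local_frac.
Proof.
split=> [|f g /local_fracP[p [q [q0 ->]]] /local_fracP[p' [q' [q'0 ->]]]
        |f g /local_fracP[p [q [q0 ->]]] /local_fracP[p' [q' [q'0 ->]]]].
- apply/local_fracP; exists 1, 1; split; last by rewrite tofrac1 divr1.
  by rewrite mcoeff1 eqxx oner_eq0.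
- apply/local_fracP; exists (p * q' - p' * q), (q * q'); split.
    by rewrite const_coefM mulf_neq0.
  by rewrite -mulNr addf_div ?tofrac_neq0 // tofracB !tofracM mulNr.
- apply/local_fracP; exists (p * p'), (q * q'); split.
    by rewrite const_coefM mulf_neq0.
  by rewrite mulf_div !tofracM.
Qed.

HB.instance Definition _ :=
  GRing.isSubringClosed.Build _ local_frac local_frac_subring.

Record local_poly := LocalPoly {
  local_val :> {fraction {mpoly k[n]}};
  _ : local_val \in local_frac }.

HB.instance Definition _ := [isSub for local_val].
HB.instance Definition _ := [Choice of local_poly by <:].
HB.instance Definition _ := [SubChoice_isSubComNzRing of local_poly by <:].

Fact local_of_subproof (p : {mpoly k[n]}) : tofrac p \in local_frac.
Proof.
apply/local_fracP; exists p, 1; split; last by rewrite tofrac1 divr1.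
by rewrite mcoeff1 eqxx oner_eq0.
Qed.

Definition local_of (p : {mpoly k[n]}) : local_poly :=
  LocalPoly (local_of_subproof p).

Definition local_max : set local_poly :=
  ideal_gen [set x | exists i : 'I_n, x = local_of 'X_i].

Definition edge_ideal (e : rel 'I_n) : set local_poly :=
  ideal_gen [set x | exists i j : 'I_n, e i j /\ x = local_of ('X_i * 'X_j)].

Lemma local_maxE (x : local_poly) : local_max x <->
  exists p q : {mpoly k[n]},
    [/\ p@_0%MM = 0, q@_0%MM != 0 & \val x = tofrac p / tofrac q].
Proof.
have one0 : (1 : {mpoly k[n]})@_0%MM != 0 by rewrite mcoeff1 eqxx oner_eq0.
split.
  pose M := [set x : local_poly | exists p q : {mpoly k[n]},
    [/\ p@_0%MM = 0, q@_0%MM != 0 & \val x = tofrac p / tofrac q]].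
  move/(_ M); apply; last first.
    move=> _ [i ->]; exists 'X_i, 1; rewrite tofrac1 divr1 mcoeffX mnm1_eq0.
    by split.
  split.
  - by exists 0, 1; rewrite mcoeff0 tofrac0 mul0r; split.
  - move=> y z [p [q [p0 q0 yE]]] [p' [q' [p'0 q'0 zE]]].
    exists (p * q' + p' * q), (q * q'); split.
    + by rewrite mcoeffD !const_coefM p0 p'0 !mul0r addr0.
    + by rewrite const_coefM mulf_neq0.
    + rewrite rmorphD /= -/(\val y) yE -/(\val z) zE.
      by rewrite addf_div ?tofrac_neq0 // tofracD !tofracM.
  - move=> a y [p [q [p0 q0 yE]]].
    have /local_fracP[p' [q' [q'0 aE]]] := valP a.
    exists (p' * p), (q' * q); split.
    + by rewrite const_coefM p0 mulr0.
    + by rewrite const_coefM mulf_neq0.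
    + by rewrite rmorphM /= -/(\val y) yE -/(\val a) aE mulf_div !tofracM.
move=> [p [q [p0 q0 xE]]].
have [I0 ID IM] := ideal_gen_ideal [set x | exists i : 'I_n, x = local_of 'X_i].
rewrite -/local_max in I0 ID IM.
have qV : (tofrac q)^-1 \in local_frac.
  by apply/local_fracP; exists 1, q; rewrite tofrac1 mul1r.
have -> : x = LocalPoly qV * local_of p.
  by apply: val_inj; rewrite rmorphM /= -/(\val x) xE mulrC.
apply: (IM).
have /origin_idealE/(_ [set r | local_max (local_of r)]) := p0.
apply=> [|_ [i ->]]; last by apply: ideal_gen_sub; exists i.
split=> /= [|r r' hr hr'|a r hr].
- by have -> : local_of 0 = 0 by apply: val_inj; rewrite /= tofrac0.
- have -> : local_of (r + r') = local_of r + local_of r'.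
    by apply: val_inj; rewrite rmorphD /= tofracD.
  exact: ID.
- have -> : local_of (a * r) = local_of a * local_of r.
    by apply: val_inj; rewrite rmorphM /= tofracM.
  exact: IM.
Qed.

Lemma local_max_unit (x : local_poly) :
  ~ local_max x <-> exists y, x * y = 1.
Proof.
split=> [xM|[y xy] xM].
  have /local_fracP[p [q [q0 xE]]] := valP x.
  have p0 : p@_0%MM != 0.
    by apply/eqP=> p0; apply: xM; apply/local_maxE; exists p, q.
  have yP : tofrac q / tofrac p \in local_frac.
    by apply/local_fracP; exists q, p.
  exists (LocalPoly yP); apply: val_inj; rewrite rmorphM /= -/(\val x) xE.
  by rewrite mulf_div mulrC [tofrac q * _]mulrC mulVf // mulf_neq0 ?tofrac_neq0.
have [_ _ IM] := ideal_gen_ideal [set x | exists i : 'I_n, x = local_of 'X_i].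
have /local_maxE[p [q [p0 q0]]] : local_max 1.
  by rewrite -xy mulrC; apply: IM.
rewrite rmorph1 => /esym /(congr1 ( *%R^~ (tofrac q))).
rewrite mul1r mulfVK ?tofrac_neq0 // => /eqP; rewrite tofrac_eq => /eqP pq.
by rewrite -pq p0 eqxx in q0.
Qed.

Lemma local_maxP (M : set local_poly) : maximal_ideal M <-> M = local_max.
Proof.
have proper I : is_ideal I -> ~ I 1 -> I `<=` local_max.
  move=> [_ _ IM] I1 x Ix; apply: contrapT => /local_max_unit[y xy].
  by apply: I1; rewrite -xy mulrC; apply: IM.
have m1 : ~ local_max 1 by apply/local_max_unit; exists 1; rewrite mulr1.
have idm : is_ideal local_max by exact: ideal_gen_ideal.
split=> [[idM M1 maxM]|->].
  by rewrite (maxM _ idm m1 (proper _ idM M1)).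
by split=> // I idI I1 mI; apply/seteqP; split=> //; apply: proper.
Qed.

End Localization.

Arguments local_max k n : clear implicits.
Arguments edge_ideal k {n} e.
Arguments origin_ideal k n : clear implicits.

(* Main.v *)
Require Import Defs.
From HB Require Import structures.
From mathcomp Require Import all_boot all_order all_algebra.
From mathcomp Require Import mpoly boolp classical_sets cardinality.
From mathcomp Require Import qfpoly ring zify.

(* Index the edges by the vertices: e_v = x_v x_(sigma v), where sigma is the
   rotation of the even cycle and sends a leaf to its neighbour. Modulo mI, an
   ideal J inside I is a subspace W of k^s; let a range over the vectors
   annihilating W.
   - If a <> 0 (possibly over an extension of k) has equal products over the two
     alternating classes of cycle edges, there is an arc x_v = y_v t^(w_v) along
     which e_v = a_v t^N + higher order terms. Then J vanishes to higher order
     than I along the arc, and J is not a reduction.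
   - If the annihilator contains a plane, the equation "equal alternating
     products" has a nonzero solution on it over an extension of k. Hence, for a
     reduction, W has codimension at most 1.
   - W = k^s would give J = I by Nakayama, but I has a proper reduction, cut out
     by the indicator a of the even cycle edges.
   - So W is the hyperplane orthogonal to some a with distinct alternating
     products. The linear syzygies of the edges then give mI <= J + m^2 I, and
     mI <= J by Nakayama. *)

Set Implicit Arguments.
Unset Strict Implicit.
Unset Printing Implicit Defensive.

Import GRing.Theory.

Local Open Scope classical_set_scope.
Local Open Scope ring_scope.

(** * Ideals and Nakayama's lemma *)

Section IdealTheory.
Variable R : comNzRingType.
Implicit Types (I J : set R) (x y : R).

Lemma ideal0 I : is_ideal I -> I 0. Proof. by case. Qed.

Lemma idealD I x y : is_ideal I -> I x -> I y -> I (x + y).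
Proof. by case=> _ + _; apply. Qed.

Lemma idealMl I a x : is_ideal I -> I x -> I (a * x).
Proof. by case=> _ _; apply. Qed.

Lemma idealMr I a x : is_ideal I -> I x -> I (x * a).
Proof. by move=> idI Ix; rewrite mulrC; apply: idealMl. Qed.

Lemma idealB I x y : is_ideal I -> I x -> I y -> I (x - y).
Proof.
by move=> idI Ix Iy; rewrite -mulN1r; apply: idealD => //; apply: idealMl.
Qed.

Lemma ideal_sum I (T : Type) (r : seq T) (P : pred T) (F : T -> R) :
  is_ideal I -> (forall t, P t -> I (F t)) -> I (\sum_(t <- r | P t) F t).
Proof.
move=> idI IF; elim/big_ind: _ => [|x y|t Pt]; [exact: ideal0| |exact: IF].
exact: idealD.
Qed.

Lemma ideal_eqmod I x y : is_ideal I -> I (x - y) -> I y -> I x.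
Proof. by move=> idI Ixy Iy; rewrite -(subrK y x); apply: idealD. Qed.

Lemma ideal_unit I u v x : is_ideal I -> u * v = 1 -> I (u * x) -> I x.
Proof.
by move=> idI uv Iux; rewrite -(mul1r x) -uv mulrAC mulrC; apply: idealMl.
Qed.

(** Chains congruences whose coefficients need not be invertible: scale the first by [a] and the
    second by [q], and the middle terms cancel. *)
Lemma ideal_eqmod_trans I p q a b x y z : is_ideal I ->
  I (p * x - q * y) -> I (a * y - b * z) -> I (p * a * x - q * b * z).
Proof.
move=> idI Ixy Iyz.
rewrite (_ : _ - _ = a * (p * x - q * y) + q * (a * y - b * z)); last by ring.
by apply: idealD => //; apply: idealMl.
Qed.

Lemma ideal_add_principal J x : is_ideal J ->
  is_ideal [set y | exists a, J (y - a * x)].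
Proof.
move=> idJ; split=> /=.
- by exists 0; rewrite mul0r subr0; apply: ideal0.
- move=> y z [a Jy] [b Jz]; exists (a + b).
  by rewrite mulrDl opprD addrACA; apply: idealD.
- move=> c y [a Jy]; exists (c * a).
  by rewrite -mulrA -mulrBr; apply: idealMl.
Qed.

Lemma subrMM y z b c e f :
  y * z - b * c * (e * f) = (y - b * e) * z + b * (e * (z - c * f)) :> R.
Proof. by ring. Qed.

Lemma ideal_gen_min (A : set R) I : is_ideal I -> A `<=` I -> ideal_gen A `<=` I.
Proof. by move=> idI AI x; apply. Qed.

Lemma ideal_gen_fin (T : finType) (g : T -> R) x :
  ideal_gen [set x | exists t, x = g t] x ->
  exists c : T -> R, x = \sum_t c t * g t.
Proof.
apply: (@ideal_gen_min _ [set x | exists c : T -> R, x = \sum_t c t * g t]).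
  split=> /=.
  - by exists (fun=> 0); rewrite big1 // => t _; rewrite mul0r.
  - move=> _ _ [c ->] [c' ->]; exists (fun t => c t + c' t).
    by rewrite -big_split; apply: eq_bigr => t _; rewrite mulrDl.
  - move=> a _ [c ->]; exists (fun t => a * c t).
    by rewrite mulr_sumr; apply: eq_bigr => t _; rewrite mulrA.
move=> _ [t ->]; exists (fun u => (u == t)%:R).
rewrite (bigD1 t) //= eqxx mul1r big1 ?addr0 // => u /negPf ->.
by rewrite mul0r.
Qed.

Lemma ideal_mul_ideal I J : is_ideal (ideal_mul I J).
Proof. exact: ideal_gen_ideal. Qed.

Lemma ideal_mul_mem I J x y : I x -> J y -> ideal_mul I J (x * y).
Proof. by move=> Ix Jy; apply: ideal_gen_sub; exists x, y. Qed.

Lemma ideal_mul_min I J L : is_ideal L ->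
  (forall x y, I x -> J y -> L (x * y)) -> ideal_mul I J `<=` L.
Proof.
by move=> idL h; apply: ideal_gen_min => // _ [x [y [Ix Jy ->]]]; apply: h.
Qed.

Lemma ideal_exp_ideal I n : is_ideal (ideal_exp I n).
Proof. by case: n => [|n]; [split | exact: ideal_mul_ideal]. Qed.

Lemma ideal_exp_pow I n x : I x -> ideal_exp I n (x ^+ n).
Proof.
by move=> Ix; elim: n => //= n IHn; rewrite exprS; apply: ideal_mul_mem.
Qed.

(** Meant for the filtration where [O i] collects the elements vanishing to order at least [i] along
    an arc. *)
Lemma ideal_exp_filtered (O : nat -> set R) I N n :
    (forall i, is_ideal (O i)) -> O 0%N = setT ->
    (forall i j x y, O i x -> O j y -> O (i + j)%N (x * y)) ->
  I `<=` O N -> ideal_exp I n `<=` O (N * n)%N.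
Proof.
move=> idO O0 OM IO; elim: n => [|n IHn]; first by rewrite muln0 O0.
rewrite mulnS; apply: ideal_mul_min => // x y Ix Iy.
by apply: OM; [apply: IO | apply: IHn].
Qed.

(* The ideal [J + M (g)], where [(g)] is generated by the family [g]. *)
Definition sum_mul_ideal (M J : set R) (T : finType) (g : T -> R) : set R :=
  [set q | exists mu : T -> R, (forall t, M (mu t)) /\ J (q - \sum_t mu t * g t)].

Lemma sum_mul_ideal_ideal M J (T : finType) (g : T -> R) :
  is_ideal M -> is_ideal J -> is_ideal (sum_mul_ideal M J g).
Proof.
move=> idM idJ; split=> /=.
- exists (fun=> 0); split=> [_|]; first exact: ideal0.
  by rewrite big1 ?subr0 => [|t _]; [exact: ideal0 | rewrite mul0r].
- move=> x y [mu [Mmu Jx]] [nu [Mnu Jy]]; exists (fun t => mu t + nu t).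
  split=> [t|]; first exact: idealD.
  rewrite (eq_bigr _ (fun t _ => mulrDl _ _ _)) big_split /= opprD addrACA.
  exact: idealD.
- move=> a x [mu [Mmu Jx]]; exists (fun t => a * mu t).
  split=> [t|]; first exact: idealMl.
  rewrite (eq_bigr _ (fun t _ => esym (mulrA _ _ _))) -mulr_sumr -mulrBr.
  exact: idealMl.
Qed.

Lemma sum_mul_ideal_sub M J (T : finType) (g : T -> R) :
  is_ideal M -> J `<=` sum_mul_ideal M J g.
Proof.
move=> idM x Jx; exists (fun=> 0); split=> [_|]; first exact: ideal0.
by rewrite big1 ?subr0 // => t _; rewrite mul0r.
Qed.

Lemma sum_mul_ideal_mul M J (T : finType) (g : T -> R) a t :
  is_ideal M -> is_ideal J -> M a -> sum_mul_ideal M J g (a * g t).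
Proof.
move=> idM idJ Ma; exists (fun u => if u == t then a else 0); split=> [u|].
  by case: ifP => // _; apply: ideal0.
rewrite (bigD1 t) //= eqxx big1 => [|u /negPf->]; last by rewrite mul0r.
by rewrite addr0 subrr; apply: ideal0.
Qed.

(* Induction on the number of generators: adding one generator [x] to [J] puts
   all the others in [J + (x)]; hence [x] lies in [J + M x], and in [J]. *)
Lemma nakayama (M : set R) (T : finType) (g : T -> R) J :
    is_ideal M -> (forall x, M x -> exists y, (1 - x) * y = 1) ->
    is_ideal J -> (forall t, sum_mul_ideal M J g (g t)) ->
  forall t, J (g t).
Proof.
move=> idM unitM idJ Jg.
suff /(_ (index_enum T)) h : forall r : seq T, forall J, is_ideal J ->
   (forall t, t \in r -> exists mu : T -> R, (forall t, M (mu t)) /\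
      J (g t - \sum_(u <- r) mu u * g u)) -> forall t, t \in r -> J (g t).
  by move=> t; apply: (h J) => // u _; apply: Jg.
elim=> [//|x r IHr] {idJ Jg}J idJ Jg.
pose J1 := [set y : R | exists a, J (y - a * g x)].
have idJ1 : is_ideal J1 by apply: ideal_add_principal.
have J1r : forall t, t \in r -> J1 (g t).
  apply: IHr => // t tr; have [|mu [Mmu Jmu]] := Jg t.
    by rewrite inE tr orbT.
  exists mu; split=> //; exists (mu x).
  by move: Jmu; rewrite big_cons [X in _ - X]addrC opprD addrA.
have Jx : J (g x).
  have [|mu [Mmu]] := Jg x; first by rewrite inE eqxx.
  rewrite big_cons => Jmu.
  (* Modulo [J] every other generator is a multiple of [g x], so the relation for [g x] becomes
     [(1 - (mu x + nu)) * g x] in [J], where the first factor is a unit. *)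
  have [nu Mnu Jnu] : exists2 nu, M nu &
      J (\sum_(u <- r) mu u * g u - nu * g x).
    have : forall t, t \in r -> J1 (g t) by [].
    elim: (r) => [|t r' IH] J1r'.
      by exists 0; rewrite ?big_nil ?mul0r ?subr0; apply: ideal0.
    have [u ur|nu Mnu Jnu] := IH; first by apply: J1r'; rewrite inE ur orbT.
    have [|a Ja] := J1r' t; first by rewrite inE eqxx.
    exists (mu t * a + nu); first by apply: idealD => //; apply: idealMr.
    rewrite big_cons mulrDl opprD addrACA; apply: idealD => //.
    by rewrite -mulrA -mulrBr; apply: idealMl.
  have [y /ideal_unit] := unitM _ (idealD idM (Mmu x) Mnu); apply=> //.
  apply: (ideal_eqmod (y := g x - (mu x * g x + \sum_(j <- r) mu j * g j))) => //.
  by rewrite (_ : _ - _ = \sum_(u <- r) mu u * g u - nu * g x) //; ring.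
move=> t; rewrite inE => /orP[/eqP->//|/J1r[a Ja]].
by apply: (ideal_eqmod idJ Ja); apply: idealMl.
Qed.

End IdealTheory.

(** * The local ring at the origin *)

Section LocalRing.
Variables (k : fieldType) (n : nat).
Local Notation P := {mpoly k[n]}.
Local Notation R := (local_poly k n).
Local Notation m := (local_max k n).

Fact local_of_is_zmod_morphism : zmod_morphism (@local_of k n).
Proof. by move=> p q; apply: val_inj; rewrite rmorphB /= tofracB. Qed.

Fact local_of_is_monoid_morphism : monoid_morphism (@local_of k n).
Proof.
split=> [|p q]; apply: val_inj; first by rewrite rmorph1 /= tofrac1.
by rewrite rmorphM /= tofracM.
Qed.

HB.instance Definition _ :=
  GRing.isZmodMorphism.Build P R (@local_of k n) local_of_is_zmod_morphism.
HB.instance Definition _ :=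
  GRing.isMonoidMorphism.Build P R (@local_of k n) local_of_is_monoid_morphism.

Lemma local_of_inj : injective (@local_of k n).
Proof. by move=> p q /(congr1 val) /= /eqP; rewrite tofrac_eq => /eqP. Qed.

Lemma local_repr (x : R) :
  exists p q : P, q@_0%MM != 0 /\ x * local_of q = local_of p.
Proof.
have /local_fracP[p [q [q0 xE]]] := valP x; exists p, q; split=> //.
by apply: val_inj; rewrite rmorphM /= -/(\val x) xE mulfVK // tofrac_neq0.
Qed.

Lemma local_max_repr (x : R) : m x <->
  exists p q : P, [/\ p@_0%MM = 0, q@_0%MM != 0 & x * local_of q = local_of p].
Proof.
rewrite local_maxE; split=> -[p [q [p0 q0 xE]]]; exists p, q; split=> //.
  by apply: val_inj; rewrite rmorphM /= -/(\val x) xE mulfVK // tofrac_neq0.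
have /(congr1 val) := xE; rewrite rmorphM /= => <-.
by rewrite mulfK // tofrac_neq0.
Qed.

Lemma local_max_ideal : is_ideal m. Proof. exact: ideal_gen_ideal. Qed.

Lemma local_max1 : ~ m 1.
Proof. by apply/local_max_unit; exists 1; rewrite mulr1. Qed.

Lemma local_max_unitB (x : R) : m x -> exists y, (1 - x) * y = 1.
Proof.
move=> mx; apply/local_max_unit => m1x; apply: local_max1.
by rewrite -(subrK x 1); apply: (idealD local_max_ideal).
Qed.

Definition local_const : k -> R := @local_of k n \o @mpolyC n k.

HB.instance Definition _ := GRing.RMorphism.on local_const.

Lemma local_const_unit (c : k) :
  c != 0 -> local_const c * local_const c^-1 = 1.
Proof. by move=> c0; rewrite -rmorphM mulfV // rmorph1. Qed.

(** The constant is the value of the fraction at the origin: the residue field is [k] itself. *)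
Lemma local_residue (x : R) : exists (c : k) (p : R), x = local_const c + p /\ m p.
Proof.
have [p [q [q0 xE]]] := local_repr x.
pose c := p@_0%MM / q@_0%MM; exists c, (x - local_const c).
split; first by rewrite addrC subrK.
apply/local_max_repr; exists (p - c%:MP * q), q; split=> //.
  by rewrite mcoeffB const_coefM mcoeffC eqxx mulr1 divfK // subrr.
by rewrite mulrBl xE -[local_const c]/(local_of c%:MP) -rmorphM -rmorphB.
Qed.

End LocalRing.

(** * Orders of vanishing along an arc *)

Lemma dvdXp (F : fieldType) (p : {poly F}) : ('X %| p) = root p 0.
Proof. by rewrite -dvdp_XsubCl subr0. Qed.

Section OrderIdeals.
Variables (k K : fieldType) (s : nat) (iota : {rmorphism k -> K}).
Variables (y : 'I_s -> K) (w : 'I_s -> nat).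
Hypothesis w_gt0 : forall v, (0 < w v)%N.
Local Notation P := {mpoly k[s]}.
Local Notation R := (local_poly k s).
Local Notation m := (local_max k s).

(* The one-parameter arc [x_v = y_v t ^ w_v] through the origin. *)
Definition arc_subst : P -> {poly K} :=
  mmap (polyC \o iota) (fun v => (y v)%:P * 'X^(w v)).

HB.instance Definition _ := GRing.RMorphism.on arc_subst.

Lemma arcX v : arc_subst 'X_v = (y v)%:P * 'X^(w v).
Proof. by rewrite /arc_subst mmapX mmap1U. Qed.

Lemma arcC c : arc_subst c%:MP = (iota c)%:P.
Proof. by rewrite /arc_subst mmapC. Qed.

Lemma arc_origin p : p@_0%MM = 0 -> 'X %| arc_subst p.
Proof.
move=> /origin_idealE; apply: (ideal_gen_min (I := [set p | 'X %| arc_subst p])).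
  split=> /= [|p1 p2|a p1]; first by rewrite rmorph0 dvdp0.
    by move=> h1 h2; rewrite rmorphD dvdp_add.
  by move=> h; rewrite rmorphM dvdp_mull.
move=> _ [v ->] /=; rewrite arcX dvdp_mull //.
by rewrite -(prednK (w_gt0 v)) exprS dvdp_mulr.
Qed.

(** The arc passes through the origin at [t = 0], so the constant term of the pullback is the image
    of that of [q]. *)
Lemma arc_coprime N q : q@_0%MM != 0 -> coprimep 'X^N (arc_subst q).
Proof.
move=> q0; apply: coprimep_expl; rewrite coprimep_sym coprimepX.
have : 'X %| arc_subst (q - (q@_0%MM)%:MP).
  by apply: arc_origin; rewrite mcoeffB mcoeffC eqxx mulr1 subrr.
rewrite dvdXp rmorphB /= arcC.
rewrite /root hornerD hornerN hornerC subr_eq0 => /eqP ->.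
by rewrite fmorph_eq0.
Qed.

(** Elements of order at least [N] along the arc. Denominators pull back to units at [t = 0], so
    only the numerator is measured. *)
Definition order_ideal N : set R :=
  [set x | exists p q : P,
     [/\ q@_0%MM != 0, x * local_of q = local_of p & 'X^N %| arc_subst p]].

Lemma order_ideal_of N p : order_ideal N (local_of p) <-> 'X^N %| arc_subst p.
Proof.
split=> [[p' [q [q0 ]]]|dp]; last first.
  by exists p, 1; rewrite mcoeff1 eqxx oner_eq0 rmorph1 mulr1.
rewrite -rmorphM => /local_of_inj <-; rewrite rmorphM /=.
by rewrite Gauss_dvdpl // arc_coprime.
Qed.

Lemma order_idealM i j x x' :
  order_ideal i x -> order_ideal j x' -> order_ideal (i + j) (x * x').
Proof.
move=> [p [q [q0 xE dp]]] [p' [q' [q'0 xE' dp']]].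
exists (p * p'), (q * q'); split; first by rewrite const_coefM mulf_neq0.
  by rewrite !rmorphM /= -xE -xE' mulrACA.
by rewrite rmorphM exprD dvdp_mul.
Qed.

Lemma order_ideal0 : order_ideal 0 = setT.
Proof.
rewrite -subTset => x _; have [p [q [q0 xE]]] := local_repr x.
by exists p, q; rewrite expr0 dvd1p.
Qed.

Lemma order_ideal_ideal N : is_ideal (order_ideal N).
Proof.
split.
- by rewrite -(rmorph0 (@local_of k s)) order_ideal_of rmorph0 dvdp0.
- move=> x x' [p [q [q0 xE dp]]] [p' [q' [q'0 xE' dp']]].
  exists (p * q' + p' * q), (q * q'); split.
  + by rewrite const_coefM mulf_neq0.
  + rewrite rmorphD !rmorphM /= -xE -xE' mulrDl mulrA.
    by rewrite [local_of q * _]mulrC mulrA.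
  + by rewrite rmorphD !rmorphM dvdp_add ?dvdp_mulr.
- move=> a x xN; rewrite -(add0n N); apply: order_idealM => //.
  by rewrite order_ideal0.
Qed.

Lemma order_ideal1 x : m x -> order_ideal 1 x.
Proof.
move=> /local_max_repr[p [q [p0 q0 xE]]]; exists p, q.
by rewrite expr1; split=> //; apply: arc_origin.
Qed.

(* Valuative criterion: an arc along which [J] vanishes to higher order than
   [I] shows that [I] is not integral over [J]. *)
Lemma arc_not_reduction (I J : set R) N p :
    I `<=` order_ideal N -> J `<=` order_ideal N.+1 ->
    I (local_of p) -> ~~ ('X^(N.+1) %| arc_subst p) ->
  ~ reduction I J.
Proof.
move=> IN JN Ip np [idJ JI [r redE]].
have : order_ideal (N.+1 + N * r) (local_of p ^+ r.+1).
  have : ideal_mul J (ideal_exp I r) (local_of p ^+ r.+1).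
    by rewrite -redE; apply: ideal_exp_pow.
  apply: ideal_mul_min; first exact: order_ideal_ideal.
  move=> x x' Jx Ix'; apply: order_idealM; first exact: JN.
  apply: ideal_exp_filtered IN _ Ix'; [exact: order_ideal_ideal| |].
    exact: order_ideal0.
  exact: order_idealM.
rewrite -rmorphXn order_ideal_of rmorphXn /=.
(* The pullback of [p] is [u t^N]. The extra order, [N (r+1) + 1] instead of [N (r+1)], forces [t]
   to divide [u^(r+1)], hence [u]. *)
have /order_ideal_of/dvdpP[u uE] := IN _ Ip.
rewrite uE exprMn -exprM addSn -mulnS exprS.
rewrite dvdp_mul2r ?expf_neq0 ?polyX_eq0 // => du.
move: np; rewrite uE exprS dvdp_mul2r ?expf_neq0 ?polyX_eq0 //.
move: du; rewrite !dvdXp.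
by rewrite !rootE horner_exp expf_eq0 /= => ->.
Qed.

End OrderIdeals.

(** * Alternating systems on an even cycle *)

Section AlternatingSystems.

(** Solve for [w] recursively from [w 0 = 0]. After [h.*2] steps the value is the difference of the
    two alternating sums, so the solution closes up when they agree. The next lemma is the
    multiplicative analogue, started at [1]. *)
Lemma alternating_add (z : nat -> int) h :
    \sum_(j < h) z j.*2 = \sum_(j < h) z j.*2.+1 ->
  exists w : nat -> int, w h.*2 = w 0%N /\ forall i, w i + w i.+1 = z i.
Proof.
move=> zE; pose w := fix w i := if i is i'.+1 then z i' - w i' else 0.
exists w; split=> [|i /=]; last by rewrite addrC subrK.
suff -> : w h.*2 = \sum_(j < h) z j.*2.+1 - \sum_(j < h) z j.*2.
  by rewrite zE subrr.
elim: h {zE} => [|h IHh]; first by rewrite !big_ord0 subrr.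
by rewrite !big_ord_recr doubleS /= IHh; ring.
Qed.

Variable K : fieldType.

Lemma alternating_mul (b : nat -> K) h :
    (forall i, b i != 0) ->
    \prod_(j < h) b j.*2 = \prod_(j < h) b j.*2.+1 ->
  exists y : nat -> K,
    [/\ forall i, y i != 0, y h.*2 = y 0%N & forall i, y i * y i.+1 = b i].
Proof.
move=> b0 bE; pose y := fix y i := if i is i'.+1 then b i' / y i' else 1.
have y0 i : y i != 0.
  by elim: i => [|i IHi] /=; rewrite ?oner_eq0 // mulf_neq0 ?invr_eq0.
exists y; split=> // [|i /=]; last by rewrite mulrC divfK.
have p0 (f : nat -> nat) n : \prod_(j < n) b (f j) != 0.
  by apply/prodf_neq0 => j _.
suff -> : y h.*2 = \prod_(j < h) b j.*2.+1 / \prod_(j < h) b j.*2.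
  by rewrite bE divff // (p0 (fun j => j.*2.+1)).
elim: h {bE} => [|h IHh]; first by rewrite !big_ord0 divr1.
rewrite !big_ord_recr doubleS /= IHh.
by field; rewrite b0 (p0 double) (p0 (fun j => j.*2.+1)).
Qed.

(** Prepares for [alternating_mul], which divides by the entries: zeros become [1], and if the
    products vanish, one zero at an odd place is used to restore their equality. *)
Lemma nonzero_modification (a : nat -> K) h :
    \prod_(j < h) a j.*2 = \prod_(j < h) a j.*2.+1 ->
  exists b : nat -> K, [/\ forall i, b i != 0,
    \prod_(j < h) b j.*2 = \prod_(j < h) b j.*2.+1 &
    forall i, (i < h.*2)%N -> a i != 0 -> b i = a i].
Proof.
move=> aE; pose b0 i := if a i == 0 then 1 else a i.
have b00 i : b0 i != 0 by rewrite /b0; case: (eqVneq (a i) 0); rewrite ?oner_eq0.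
have b0E i : a i != 0 -> b0 i = a i by rewrite /b0 => /negPf ->.
have p0 (f : nat -> nat) n : \prod_(j < n) b0 (f j) != 0.
  by apply/prodf_neq0 => j _.
have [z|nz] := eqVneq (\prod_(j < h) a j.*2.+1) 0; last first.
  exists b0; split=> //; last by move=> i _; apply: b0E.
  have nz' := nz; rewrite -aE in nz'.
  move/prodf_neq0: nz => nz; move/prodf_neq0: nz' => nz'.
  rewrite [LHS](eq_bigr (fun j : 'I_h => a j.*2)) ?aE => [|j _]; last first.
    by rewrite b0E ?nz'.
  by apply: eq_bigr => j _; rewrite b0E ?nz.
have /eqP/prodf_eq0[p _ /eqP ap] := z.
(* Since [a p.*2.+1 = 0], the value there is free; [c] is the one that balances the products. *)
pose c := \prod_(j < h) b0 j.*2 / \prod_(j < h) b0 j.*2.+1.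
have c0 : c != 0 by rewrite mulf_neq0 ?invr_eq0 ?(p0 double) ?(p0 (fun j => j.*2.+1)).
exists (fun i => if i == p.*2.+1 then c else b0 i); split.
- by move=> i; case: (i == _).
- rewrite (bigD1 p) // [RHS](bigD1 p) //= eqxx.
  rewrite [X in c * X](eq_bigr (fun j : 'I_h => b0 j.*2.+1)); last first.
    move=> j /negPf jp; rewrite eqSS (inj_eq double_inj).
    by rewrite -[(_ == _ :> nat)]/(j == p) jp.
  have -> : c = \prod_(j < h) b0 j.*2 / \prod_(j < h | j != p) b0 j.*2.+1.
    rewrite /c [X in _ / X](bigD1 p) //=.
    by rewrite {2}/b0 ap eqxx mul1r.
  rewrite divfK; last by apply/prodf_neq0 => j _.
  rewrite [RHS](bigD1 p) //=; congr (_ * _).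
    by case: eqP => // /(congr1 odd); rewrite /= !odd_double.
  apply: eq_bigr => j _.
  by case: eqP => // /(congr1 odd); rewrite /= !odd_double.
- by move=> i _ ai; case: (eqVneq i p.*2.+1) ai => [->|_ /b0E//]; rewrite ap eqxx.
Qed.

Lemma weights_exist (a : nat -> K) h :
    \prod_(j < h) a j.*2 = \prod_(j < h) a j.*2.+1 ->
  exists w : nat -> int, w h.*2 = w 0%N /\ forall i, (i < h.*2)%N ->
    if a i == 0 then 0 < w i + w i.+1 else w i + w i.+1 == 0.
Proof.
(* Each zero at an even place gets the number [co] of zeros at odd places, and conversely, so both
   alternating sums are [ce * co]. Equal products mean that a zero in one class forces one in the
   other, whence positivity. *)
move=> aE; pose ce : nat := (\sum_(j < h) (a j.*2 == 0%R))%N.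
pose co : nat := (\sum_(j < h) (a j.*2.+1 == 0%R))%N.
pose z i : int := ((a i == 0%R) * (if odd i then ce else co))%N.
have [|w [w0 wE]] := @alternating_add z h.
  have -> : \sum_(j < h) z j.*2 = (ce * co)%N :> int.
    rewrite big_distrl /= -natz natr_sum; apply: eq_bigr => j _.
    by rewrite /z odd_double natz.
  rewrite mulnC big_distrl /= -natz natr_sum; apply: eq_bigr => j _.
  by rewrite /z /= odd_double natz.
exists w; split=> // i ih; rewrite wE /z; case: eqP => // ai0; rewrite mul1n.
have half_lt : (i./2 < h)%N by lia.
have [oi|ei] := boolP (odd i).
  have : \prod_(j < h) a j.*2 == 0.
    rewrite aE; apply/prodf_eq0; exists (Ordinal half_lt) => //=.
    by move: (odd_double_half i); rewrite oi add1n => ->; apply/eqP.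
  move=> /prodf_eq0[j _ aj]; rewrite /ce (bigD1 j) //= aj; lia.
have : \prod_(j < h) a j.*2.+1 == 0.
  rewrite -aE; apply/prodf_eq0; exists (Ordinal half_lt) => //=.
  by move: (odd_double_half i); rewrite (negPf ei) add0n => ->; apply/eqP.
move=> /prodf_eq0[j _ aj]; rewrite /co (bigD1 j) //= aj; lia.
Qed.

End AlternatingSystems.

(** * Field extensions and subspaces *)

Lemma irreducible_factor (F : fieldType) (g : {poly F}) : (1 < size g)%N ->
  exists2 p : {poly F}, irreducible_poly p & p %| g.
Proof.
have [n] := ubnP (size g); elim: n g => // n IHn g gn g1.
have [irr|nirr] := pselect (irreducible_poly g); first by exists g.
have [q [q1 qg nqg]] : exists q : {poly F}, [/\ size q != 1%N, q %| g & ~~ (q %= g)].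
  apply: contrapT => nq; apply: nirr; split=> // q q1 qg.
  by apply: contrapT => /negP nqg; apply: nq; exists q.
have g0 : g != 0 by rewrite -size_poly_gt0 ltnW.
have q0 : q != 0 by apply: contraNneq g0 => q0; rewrite q0 dvd0p in qg.
have qlt : (size q < size g)%N.
  rewrite ltn_neqAle dvdp_leq // andbT; apply: contra nqg => sqg.
  by rewrite -dvdp_size_eqp.
have [||p irrp pq] := IHn q; first exact: leq_trans qlt gn.
  by rewrite ltn_neqAle eq_sym q1 size_poly_gt0.
by exists p => //; apply: dvdp_trans qg.
Qed.

(** The field is the quotient of [{poly F}] by a monic irreducible factor of [g], and the root is
    the class of ['X]. *)
Lemma extension_root (F : fieldType) (g : {poly F}) : (1 < size g)%N ->
  exists (K : fieldType) (iota : {rmorphism F -> K}) (z : K),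
    root (map_poly iota g) z.
Proof.
move=> /irreducible_factor[p0 irrp0 p0g].
have p00 : p0 != 0 by rewrite irredp_neq0.
pose p := (lead_coef p0)^-1 *: p0.
have lc0 : (lead_coef p0)^-1 != 0 by rewrite invr_eq0 lead_coef_eq0.
have pp0 : p %= p0 by apply: eqp_scale.
have mp : p \is monic by rewrite monicE lead_coefZ mulVf // lead_coef_eq0.
have irrp : irreducible_poly p.
  case: irrp0 => s1 irr; split=> [|q q1 qp]; first by rewrite (eqp_size pp0).
  by rewrite (eqp_trans (irr q q1 _)) // ?(eqp_sym p0) // -(eqp_dvdr _ pp0).
pose mi : monic_irreducible_poly p := (irrp, mp).
pose K : fieldType := {poly %/ p with mi}.
pose f : {rmorphism {poly F} -> K} :=
  GRing.RMorphism.clone _ _ (in_qpoly p : {poly F} -> K) _.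
exists K, (f \o polyC), (f 'X).
have fp : f p = 0.
  apply: val_inj => /=; rewrite /mk_monic irrp.1 mp /=.
  exact: Pdiv.RingMonic.rmodpp.
rewrite /root map_poly_comp horner_map -/(comp_poly 'X g) comp_polyXr.
have : p %| g by rewrite (eqp_dvdl _ pp0).
by move=> /dvdpP[r ->]; rewrite rmorphM fp mulr0.
Qed.

(** Take a row space of maximal rank inside [W]: a vector of [W] outside it would raise the rank.
    The matrix gives access to the annihilator through its cokernel. *)
Lemma closed_row_space (F : fieldType) n (W : set 'rV[F]_n) :
    W 0 -> (forall u v, W u -> W v -> W (u + v)) ->
    (forall a u, W u -> W (a *: u)) ->
  exists M : 'M[F]_n, forall u, W u <-> (u <= M)%MS.
Proof.
move=> W0 WD WZ.
pose P r := `[< exists2 M : 'M[F]_n, forall u, (u <= M)%MS -> W u & \rank M = r >].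
have exP : exists r, P r.
  by exists 0%N; apply/asboolP; exists 0; rewrite ?mxrank0 // => u /submx0null->.
have ubP r : P r -> (r <= n)%N by move=> /asboolP[M _ <-]; apply: rank_leq_row.
case: (ex_maxnP exP ubP) => r /asboolP[M WM rM] maxr; exists M => u.
split=> [Wu|]; last exact: WM.
apply: contrapT => /negP nuM.
have : (M < M + u)%MS by rewrite ltmxE addsmxSl addsmx_sub submx_refl.
move=> /rank_ltmx; rewrite rM ltnNge => /negP; apply; apply: maxr.
apply/asboolP; exists (M + u)%MS => // v /sub_addsmxP[[b c] ->] /=.
apply: WD; first by apply: WM; apply: submxMl.
by rewrite (mx11_scalar c) mul_scalar_mx; apply: WZ.
Qed.

(** * The edge ideal of an even cycle with leaves *)

Section CycleWithLeaves.
Variables (s h : nat) (sigma : 'I_s -> 'I_s).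
Hypotheses (h_gt1 : (1 < h)%N) (hs : (h.*2 <= s)%N).
Hypothesis sigma_lt : forall v, (sigma v < h.*2)%N.
Hypothesis sigma_cycle :
  forall v : 'I_s, (v < h.*2)%N -> sigma v = (v.+1 %% h.*2)%N :> nat.

Fact cyc_subproof i : (i %% h.*2 < s)%N.
Proof. by apply: leq_trans hs; rewrite ltn_mod; lia. Qed.

Definition cyc i : 'I_s := Ordinal (cyc_subproof i).

Lemma cyc_small (v : 'I_s) : (v < h.*2)%N -> cyc v = v.
Proof. by move=> vd; apply: val_inj; rewrite /= modn_small. Qed.

Lemma sigma_cyc i : sigma (cyc i) = cyc i.+1.
Proof.
apply: val_inj; rewrite /= sigma_cycle /=; last by rewrite ltn_mod; lia.
by rewrite -addn1 modnDml addn1.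
Qed.

Lemma cycDd i : cyc (i + h.*2) = cyc i.
Proof. by apply: val_inj; rewrite /= modnDr. Qed.

(** On the cycle, [y] solves the system for a nonvanishing modification of [a], and the weights push
    an edge above order [N] exactly when its [a] vanishes. Each leaf coordinate is then chosen to
    give its edge order [N] and coefficient [a v]. *)
Lemma arc_exists (K : fieldType) (a : 'I_s -> K) :
    \prod_(j < h) a (cyc j.*2) = \prod_(j < h) a (cyc j.*2.+1) ->
  exists (y : 'I_s -> K) (w : 'I_s -> nat) (N : nat),
    (forall v, (0 < w v)%N) /\
    forall v, ((w v + w (sigma v))%N = N /\ y v * y (sigma v) = a v) \/
              ((N < w v + w (sigma v))%N /\ a v = 0).
Proof.
move=> aE; have [b [b0 bE ba]] := nonzero_modification (a := a \o cyc) aE.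
have [y [y0 yd yE]] := alternating_mul b0 bE.
have [w [wd wE]] := weights_exist (a := a \o cyc) aE.
(* Shifting the integer weights by [C + 1] puts them between [1] and [2C + 1], so cycle weights and
   leaf weights [N - W (sigma v)], with [N = 2(C + 1)], are all positive. *)
pose C := (\max_(i < h.*2.+1) `|w i|)%N.
have wC i : (i < h.*2)%N -> (`|w i| <= C)%N.
  move=> id; have id' : (i < h.*2.+1)%N by lia.
  exact: (leq_bigmax (F := fun j : 'I_h.*2.+1 => `|w j|%N) (Ordinal id')).
pose W i : nat := absz (w i + Posz C.+1).
pose W' (v : 'I_s) := if (v < h.*2)%N then W v else (C.+1.*2 - W (sigma v))%N.
pose Y (v : 'I_s) := if (v < h.*2)%N then y v else a v / y (sigma v).
exists Y, W', C.+1.*2; split=> [v|v].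
  rewrite /W' /W; case: ifP => vd; first by have := wC _ vd; lia.
  by have := wC _ (sigma_lt v); lia.
rewrite /Y /W' sigma_lt; case: ifP => vd; last first.
  left; rewrite divfK //; split=> //.
  by rewrite /W; have := wC _ (sigma_lt v); lia.
have wS : w (sigma v) = w v.+1 /\ y (sigma v) = y v.+1.
  rewrite sigma_cycle //; have [/modn_small->//|dv] := ltnP v.+1 h.*2.
  have -> : v.+1 = h.*2 by lia.
  by rewrite modnn.
have := wE v vd; have := ba v vd; rewrite /= cyc_small // /W.
have := wC _ vd; have := wC _ (sigma_lt v).
case: wS => -> ->; case: eqP => [av0|/eqP av0] w1 w2 bav ww.
  by right; split=> //; lia.
by left; split; [lia | rewrite yE bav].
Qed.

Variable k : fieldType.
Local Notation R := (local_poly k s).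
Local Notation m := (local_max k s).

Definition edge v : {mpoly k[s]} := 'X_v * 'X_(sigma v).

Definition ledge v : R := local_of (edge v).

Definition ledge_ideal : set R := ideal_gen [set x | exists v, x = ledge v].

Lemma ledge_mem v : ledge_ideal (ledge v).
Proof. by apply: ideal_gen_sub; exists v. Qed.

Lemma ledge_ideal_residue x : ledge_ideal x ->
  exists (c : 'I_s -> k) (mu : 'I_s -> R), (forall v, m (mu v)) /\
    x = \sum_v local_const s (c v) * ledge v + \sum_v mu v * ledge v.
Proof.
move=> /ideal_gen_fin[r ->].
have [f fE] := choice (fun v => local_residue (r v)).
have [g gE] := choice fE.
exists f, g; split=> [v|]; first by case: (gE v).
rewrite -big_split; apply: eq_bigr => v _ /=.
by rewrite -mulrDl; case: (gE v) => <-.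
Qed.

(** Along the arc of [arc_exists], the leading terms [a v t^N] cancel in every element of [J], while
    the edge of [v0] has order exactly [N]. *)
Lemma cycle_relation_not_reduction (K : fieldType) (iota : {rmorphism k -> K})
    (a : 'I_s -> K) v0 (J : set R) :
    a v0 != 0 ->
    \prod_(j < h) a (cyc j.*2) = \prod_(j < h) a (cyc j.*2.+1) ->
    (forall c : 'I_s -> k,
       sum_mul_ideal m J ledge (\sum_v local_const s (c v) * ledge v) ->
       \sum_v iota (c v) * a v = 0) ->
  ~ reduction ledge_ideal J.
Proof.
move=> av0 aE aW redJ; have [idJ JI _] := redJ.
have [y [w [N [w0 yw]]]] := arc_exists aE.
have edgeE v : arc_subst iota y w (edge v) =
    (y v * y (sigma v))%:P * 'X^(w v + w (sigma v)).
  by rewrite rmorphM /= !arcX mulrACA -polyCM -exprD.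
have edge_dvd v : 'X^(N.+1) %| arc_subst iota y w (edge v) - (a v)%:P * 'X^N.
  rewrite edgeE; case: (yw v) => [[-> ->]|[Nw ->]]; first by rewrite subrr dvdp0.
  by rewrite mul0r subr0 dvdp_mull // dvdp_exp2l.
have eN v : order_ideal iota y w N (ledge v).
  rewrite order_ideal_of // edgeE dvdp_mull // dvdp_exp2l //.
  by case: (yw v) => [[-> _]|[/ltnW]].
have idO := order_ideal_ideal iota y w0.
apply: (arc_not_reduction w0 (p := edge v0) _ _ _ _ redJ).
- apply: ideal_gen_min => [|_ [v ->]]; [exact: idO | exact: eN].
- move=> j Jj; have [c [mu [mmu jE]]] := ledge_ideal_residue (JI _ Jj).
  have /aW ca : sum_mul_ideal m J ledge (\sum_v local_const s (c v) * ledge v).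
    exists (fun v => - mu v); split=> [v|].
      by rewrite -mulN1r; apply: (idealMl _ (local_max_ideal k s)).
    under [X in _ - X]eq_bigr do rewrite mulNr.
    by rewrite sumrN opprK -jE.
  rewrite jE; apply: (idealD (idO _)); last first.
    apply: (ideal_sum _ (idO _)) => v _.
    by rewrite -add1n; apply: order_idealM => //; apply: order_ideal1.
  have -> : \sum_v local_const s (c v) * ledge v =
            local_of (\sum_v (c v)%:MP * edge v).
    by rewrite rmorph_sum; apply: eq_bigr => v _; rewrite rmorphM.
  rewrite order_ideal_of // rmorph_sum /=.
  (* The leading terms may be subtracted because their combination is zero by [ca]; each remaining
     summand is divisible by [t^(N+1)]. *)
  have -> : \sum_v arc_subst iota y w ((c v)%:MP * edge v) =
      \sum_v (iota (c v))%:P * (arc_subst iota y w (edge v) - (a v)%:P * 'X^N).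
    transitivity (\sum_v (arc_subst iota y w ((c v)%:MP * edge v) -
        (iota (c v) * a v)%:P * 'X^N)).
      by rewrite sumrB -mulr_suml -(rmorph_sum (@polyC K)) ca rmorph0 mul0r subr0.
    by apply: eq_bigr => v _; rewrite rmorphM /= arcC polyCM mulrBr mulrA.
  elim/big_ind: _ => [|p q dp dq|v _]; first exact: dvdp0.
    exact: dvdp_add.
  exact: dvdp_mull.
- exact: ledge_mem.
- apply: contra av0 => av0; rewrite -(rootC _ 0) -dvdXp.
  rewrite -(@dvdp_mul2r _ 'X^N) ?expf_neq0 ?polyX_eq0 // -exprS.
  by rewrite -[_ * _](subKr (arc_subst iota y w (edge v0))) dvdp_sub.
Qed.

(** * Hyperplanes and linear syzygies around the cycle *)

Lemma prod_cyclic_shift (S : comNzRingType) (F : nat -> S) n :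
  F n = F 0%N -> \prod_(j < n) F j.+1 = \prod_(j < n) F j.
Proof.
case: n => [|n] Fn; first by rewrite !big_ord0.
by rewrite big_ord_recr [RHS]big_ord_recl /= Fn mulrC.
Qed.

(** Starts at [0] and [1] give the two alternating classes of cycle edges; an arbitrary start allows
    walking around the cycle from any vertex. *)
Definition alt_prod (S : comNzRingType) (a : 'I_s -> S) i :=
  \prod_(j < h) a (cyc (i + j.*2)).

Lemma alt_prodS2 (S : comNzRingType) (a : 'I_s -> S) i :
  alt_prod a i.+2 = alt_prod a i.
Proof.
rewrite /alt_prod -(prod_cyclic_shift (F := fun j => a (cyc (i + j.*2)))).
  by apply: eq_bigr => j _; rewrite doubleS !addnS.
by rewrite addn0 cycDd.
Qed.

Lemma alt_prod_parity (S : comNzRingType) (a : 'I_s -> S) i :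
  alt_prod a i = alt_prod a (odd i).
Proof.
rewrite -[in LHS](odd_double_half i); elim: (i./2) => [|n <-].
  by rewrite addn0.
by rewrite doubleS !addnS alt_prodS2.
Qed.

(* Modulo the hyperplane [a^perp] every edge is [a_v] times a single class
   [eps]. The linear syzygies on paths [v - u - w] turn into
   [a_(uw) x_v eps = a_(uv) x_w eps]; going once around the cycle in steps of
   two multiplies [x_v eps] by the two alternating products, so that the class
   of [x_v eps] vanishes when they differ. *)
Lemma hyperplane_socle (a : 'I_s -> k) (J : set R) :
    is_ideal J -> alt_prod a 0 != alt_prod a 1 ->
    (forall u v, sum_mul_ideal m J ledge
       (local_const s (a u) * ledge v - local_const s (a v) * ledge u)) ->
  forall u v, J (local_of 'X_u * ledge v).
Proof.
move=> idJ aP aW; have idm := local_max_ideal k s.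
pose g (p : 'I_s * 'I_s) : R := local_of 'X_p.1 * ledge p.2.
(* The products in [g] generate [mI], so by Nakayama it suffices to place them in [J + m^2 I]. *)
suff Qg t : sum_mul_ideal m J g (g t).
  move=> u v; have := @nakayama _ m _ g J idm (@local_max_unitB k s) idJ.
  by move=> /(_ Qg (u, v)).
pose Q := sum_mul_ideal m J g; rewrite -/Q.
have idQ : is_ideal Q by apply: sum_mul_ideal_ideal.
have xW q u : sum_mul_ideal m J ledge q -> Q (local_of 'X_u * q).
  move=> [mu [mmu Jq]].
  apply: (ideal_eqmod (y := local_of 'X_u * (\sum_t mu t * ledge t))) => //.
    by rewrite -mulrBr; apply: sum_mul_ideal_sub => //; apply: idealMl.
  rewrite mulr_sumr; apply: ideal_sum => // v _; rewrite mulrCA.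
  apply: (@sum_mul_ideal_mul _ _ _ _ g _ (u, v)) => //.
have [u0 au0] : exists u, a u != 0.
  apply: contrapT => a0; case/eqP: aP; apply: eq_bigr => j _.
  have a0' u : a u = 0.
    by apply/eqP; apply: contrapT => /negP au; apply: a0; exists u.
  by rewrite !a0'.
(* The edge at [u0], where [a] is nonzero, represents the class [eps] up to the unit [a u0]. *)
pose X w : R := local_of 'X_w * ledge u0.
have congX w v :
    Q (local_const s (a u0) * (local_of 'X_w * ledge v) - local_const s (a v) * X w).
  have := xW _ w (aW u0 v); rewrite mulrBr.
  by rewrite mulrCA [_ * (_ * ledge u0)]mulrCA.
suff QX w : Q (X w).
  case: t => w v; apply: (ideal_unit idQ (local_const_unit s au0)).
  by apply: (ideal_eqmod idQ (congX w v)); apply: idealMl.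
have syz v v' u1 u2 : local_of 'X_v * ledge u2 = local_of 'X_v' * ledge u1 ->
    Q (local_const s (a u2) * X v - local_const s (a u1) * X v').
  move=> E; have := idealB idQ (congX v' u1) (congX v u2).
  by rewrite E opprB addrC addrA subrK.
have step i : Q (local_const s (a (cyc i.+1)) * X (cyc i)
               - local_const s (a (cyc i)) * X (cyc i.+2)).
  apply: syz; rewrite /ledge /edge !sigma_cyc -!rmorphM /=; congr local_of.
  by rewrite [RHS]mulrC mulrA.
have chain i n : Q (local_const s (\prod_(j < n) a (cyc (i.+1 + j.*2))) * X (cyc i)
     - local_const s (\prod_(j < n) a (cyc (i + j.*2))) * X (cyc (i + n.*2))).
  elim: n => [|n IHn].
    by rewrite !big_ord0 addn0 subrr; apply: ideal0.
  rewrite !big_ord_recr /= !rmorphM; apply: (ideal_eqmod_trans idQ IHn).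
  by rewrite doubleS !addnS addSn; apply: step.
have QXc i : Q (X (cyc i)).
  have := chain i h; rewrite cycDd -mulrBl -rmorphB.
  rewrite -/(alt_prod a i) -/(alt_prod a i.+1).
  apply: (ideal_unit idQ); apply: local_const_unit.
  rewrite alt_prod_parity (alt_prod_parity a i) /= subr_eq0.
  by case: (odd i); rewrite //= eq_sym.
have [wd|dw] := ltnP w h.*2; first by rewrite -(cyc_small wd).
have [i iE] : exists i, sigma w = cyc i.+1.
  (* A full turn is added before taking the predecessor, to cover [sigma w = 0]. *)
  exists ((sigma w) + h.*2).-1; rewrite prednK; last by lia.
  by rewrite cycDd cyc_small.
(* For a leaf, compare its edge with the two cycle edges at its neighbour. They have opposite
   parities, so if [a] vanished on both, both alternating products would be zero. *)
have Q1 : Q (local_const s (a (cyc i.+1)) * X w).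
  apply: (ideal_eqmod (y := local_const s (a w) * X (cyc i.+2))) => //; last first.
    exact: idealMl.
  apply: syz; rewrite /ledge /edge iE sigma_cyc -!rmorphM /=; congr local_of.
  by rewrite [RHS]mulrC mulrA.
have Q2 : Q (local_const s (a (cyc i)) * X w).
  apply: (ideal_eqmod (y := local_const s (a w) * X (cyc i))) => //; last first.
    exact: idealMl.
  apply: syz; rewrite /ledge /edge iE sigma_cyc -!rmorphM /=; congr local_of.
  by rewrite [RHS]mulrCA.
have [ai|ai] := eqVneq (a (cyc i)) 0; last first.
  exact: (ideal_unit idQ (local_const_unit s ai)).
have [ai'|ai'] := eqVneq (a (cyc i.+1)) 0; last first.
  exact: (ideal_unit idQ (local_const_unit s ai')).
have P0 j : a (cyc j) = 0 -> alt_prod a (odd j) = 0.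
  move=> aj; rewrite -alt_prod_parity; apply/eqP/prodf_eq0.
  by exists (Ordinal (ltnW h_gt1)) => //=; rewrite addn0 aj.
move: (P0 _ ai) (P0 _ ai') => /=.
by case: (odd i) => /= E1 E2; rewrite E1 E2 eqxx in aP.
Qed.

(** * A proper reduction of the edge ideal *)

Lemma edge_mnm_inj u v :
  (U_(u) + U_(sigma u) = U_(v) + U_(sigma v))%MM -> u = v.
Proof.
move=> E; have [//|uv] := eqVneq u v.
have /mnmP/(_ u) := E; have /mnmP/(_ v) := E; rewrite !mnmDE !mnm1E !eqxx.
rewrite (negPf uv) [v == u]eq_sym (negPf uv) !add0n.
(* The remaining case is that [sigma] swaps [u] and [v]. Both then lie on the cycle, and two steps
   around it would be a full turn, impossible for length at least four. *)
case: (eqVneq (sigma u) v) => // su _; case: (eqVneq (sigma v) u) => // sv _.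
have ud : (u < h.*2)%N by rewrite -sv.
have vd : (v < h.*2)%N by rewrite -su.
have := sigma_cycle ud; have := sigma_cycle vd; rewrite su sv => uE vE.
have [u1|u1] := ltnP u.+1 h.*2; have [v1|v1] := ltnP v.+1 h.*2.
- by move: uE vE; rewrite !modn_small //; lia.
- have v2 : v.+1 = h.*2 by lia.
  by move: uE vE; rewrite v2 modnn modn_small //; lia.
- have u2 : u.+1 = h.*2 by lia.
  by move: uE vE; rewrite u2 modnn modn_small //; lia.
- by apply: val_inj => /=; lia.
Qed.

Lemma edgeE v : edge v = 'X_[U_(v) + U_(sigma v)].
Proof. by rewrite /edge mpolyXD. Qed.

Lemma edge_coeff u v : (edge u)@_(U_(v) + U_(sigma v)) = (u == v)%:R.
Proof.
rewrite edgeE mcoeffX; congr (nat_of_bool _)%:R.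
by apply/eqP/eqP => [/edge_mnm_inj|->].
Qed.

Lemma edge_coeff_low u mm : (mdeg mm < 2)%N -> (edge u)@_mm = 0.
Proof.
rewrite edgeE mcoeffX => mm2; case: eqP => // E.
by move: mm2; rewrite -E mdegD !mdeg1.
Qed.

(** Any splitting of [mm] other than [0 + mm] leaves for [p] a monomial of degree below [N]. *)
Lemma mcoeffM_low (p q : {mpoly k[s]}) N mm :
    (forall mm', (mdeg mm' < N)%N -> p@_mm' = 0) -> (mdeg mm <= N)%N ->
  (q * p)@_mm = q@_0%MM * p@_mm.
Proof.
move=> p0 mmN; rewrite mcoeffM.
have lt0 : (mdeg (0%MM : 'X_{1..s}) < (mdeg mm).+1)%N by rewrite mdeg0.
rewrite (bigD1 (BMultinom lt0, BMultinom (ltnSn (mdeg mm)))) /=; last first.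
  by rewrite add0m.
rewrite big1 ?addr0 // => -[m1 m2] /= /andP[/eqP mE ne].
rewrite [p@__]p0 ?mulr0 //; apply: leq_trans mmN.
have degE := etrans (congr1 (@mdeg s) mE) (mdegD _ _).
suff : mdeg m1 != 0%N by move: degE; lia.
rewrite mdeg_eq0; apply: contra ne => /eqP m10.
rewrite xpair_eqE -!val_eqE /= m10 eqxx /=.
by move: mE; rewrite m10 add0m eq_sym => /eqP.
Qed.

Section ProperReduction.
Variable a : 'I_s -> k.
Hypothesis a0 : a (cyc 0) = 1.

(** As [a (cyc 0) = 1], the coefficient vectors of these generators span the hyperplane orthogonal
    to [a]. *)
Definition hyperplane_ideal : set R :=
  ideal_gen [set x | exists v,
    x = ledge v - local_const s (a v) * ledge (cyc 0)].

(** The functional [L] pairs the edge coefficients with [a]. On polynomials without terms of degree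
    below two, [L (q * p)] is [q(0)] times [L p], so its kernel defines an ideal [H]; it contains
    the generators, while [L] is [1] on the edge of [cyc 0]. *)
Lemma hyperplane_ideal_proper : ~ hyperplane_ideal (ledge (cyc 0)).
Proof.
pose L (p : {mpoly k[s]}) := \sum_v a v * p@_(U_(v) + U_(sigma v)).
pose low (p : {mpoly k[s]}) :=
  forall mm : 'X_{1..s}, (mdeg mm < 2)%N -> p@_mm = 0.
have lowD p q : low p -> low q -> low (p + q).
  by move=> lp lq mm mm2; rewrite mcoeffD lp ?lq ?addr0.
have lowM p q : low p -> low (q * p).
  by move=> lp mm mm2; rewrite (mcoeffM_low _ lp) ?lp ?mulr0 // ltnW.
have LD p q : L (p + q) = L p + L q.
  by rewrite -big_split; apply: eq_bigr => v _; rewrite mcoeffD mulrDr.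
have LM p q : low p -> L (q * p) = q@_0%MM * L p.
  move=> lp; rewrite mulr_sumr; apply: eq_bigr => v _.
  by rewrite (mcoeffM_low _ lp) ?mdegD ?mdeg1 // mulrCA.
have Le v : L (edge v) = a v.
  rewrite /L (bigD1 v) //= edge_coeff eqxx mulr1 big1 ?addr0 // => u uv.
  by rewrite edge_coeff eq_sym (negPf uv) mulr0.
pose H : set R := [set x | exists p q : {mpoly k[s]},
  [/\ q@_0%MM != 0, x * local_of q = local_of p, low p & L p = 0]].
have lowe v : low (edge v) by move=> mm; apply: edge_coeff_low.
suff HH : hyperplane_ideal `<=` H.
  move=> /HH[p [q [q0 + lp]]].
  rewrite /ledge -rmorphM => /local_of_inj <-; rewrite mulrC LM // Le a0 mulr1.
  by move/eqP: q0.
apply: ideal_gen_min => [|_ [v ->]]; last first.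
  exists (edge v + (- a v)%:MP * edge (cyc 0)), 1.
  rewrite mcoeff1 eqxx oner_eq0 rmorph1 mulr1; split=> //.
  - by rewrite rmorphD rmorphM mpolyCN rmorphN mulNr.
  - by apply: lowD => //; apply: lowM.
  - by rewrite LD LM // !Le a0 mulr1 mcoeffC eqxx mulr1 subrr.
split.
- exists 0, 1; rewrite mcoeff1 eqxx oner_eq0 rmorph0 mul0r; split=> //.
    by move=> mm _; rewrite mcoeff0.
  by rewrite /L big1 // => v _; rewrite mcoeff0 mulr0.
- move=> x x' [p [q [q0 xE lp Lp]]] [p' [q' [q'0 xE' lp' Lp']]].
  exists (q' * p + q * p'), (q * q'); split.
  + by rewrite const_coefM mulf_neq0.
  + rewrite rmorphD !rmorphM /= -xE -xE' mulrDl.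
    by congr (_ + _); [rewrite [RHS]mulrC mulrA | rewrite mulrCA].
  + by apply: lowD; apply: lowM.
  + by rewrite LD !LM // Lp Lp' !mulr0 addr0.
- move=> b x [p [q [q0 xE lp Lp]]].
  have [p' [q' [q'0 bE]]] := local_repr b.
  exists (p' * p), (q' * q); split.
  + by rewrite const_coefM mulf_neq0.
  + by rewrite !rmorphM /= -xE -bE mulrACA.
  + exact: lowM.
  + by rewrite LM // Lp mulr0.
Qed.

Hypothesis aP0 : alt_prod a 0 = 1.
Hypothesis aP1 : alt_prod a 1 = 0.

(** Modulo the hyperplane ideal each edge is [a v * e0]. The two alternating products of edges are
    the same monomial, yet they reduce to [e0 ^+ h] and to [0]; hence [e0 ^+ h] lies in
    [J' I^(h-1)], and so does all of [I^h]. *)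
Lemma hyperplane_ideal_reduction : reduction ledge_ideal hyperplane_ideal.
Proof.
set e0 := ledge (cyc 0); set J' := hyperplane_ideal; set I := ledge_ideal.
have idJ : is_ideal J' by apply: ideal_gen_ideal.
have idI : is_ideal I by apply: ideal_gen_ideal.
have JI : J' `<=` I.
  apply: ideal_gen_min => // _ [v ->].
  by apply: (idealB idI); [|apply: (idealMl _ idI)]; apply: ledge_mem.
have Je v : J' (ledge v - local_const s (a v) * e0).
  by apply: ideal_gen_sub; exists v.
pose Q n := ideal_mul J' (ideal_exp I n).
have idQ n : is_ideal (Q n) by apply: ideal_mul_ideal.
have Qe n x : Q n x -> Q n.+1 (e0 * x).
  have : is_ideal [set x | Q n.+1 (e0 * x)].
    split=> /= [|y z|b y]; first by rewrite mulr0; apply: ideal0.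
      by rewrite mulrDr; apply: idealD.
    by rewrite mulrCA; apply: idealMl.
  move=> /ideal_mul_min/[apply]; apply=> j z Jj Iz /=; rewrite mulrCA.
  by apply: ideal_mul_mem => //; apply: ideal_mul_mem => //; apply: ledge_mem.
have prodQ (f : nat -> 'I_s) n : Q n (\prod_(j < n.+1) ledge (f j) -
    local_const s (\prod_(j < n.+1) a (f j)) * e0 ^+ n.+1).
  elim: n => [|n IHn].
    rewrite !big_ord1 expr1 -[X in Q _ X]mulr1.
    exact: ideal_mul_mem.
  rewrite big_ord_recr [in local_const s _]big_ord_recr /=.
  rewrite [_ * ledge _]mulrC [_ * a _]mulrC rmorphM [e0 ^+ n.+2]exprS subrMM.
  apply: (idealD (idQ _)) => //; last by apply: (idealMl _ (idQ _)) => //; apply: Qe.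
  apply: ideal_mul_mem => //; elim: (n.+1) => [|l IHl].
    by rewrite big_ord0.
  by rewrite big_ord_recr /= mulrC; apply: ideal_mul_mem => //; apply: ledge_mem.
have I_e0 y : I y -> exists b, J' (y - b * e0).
  move=> /ideal_gen_fin[c ->]; exists (\sum_v c v * local_const s (a v)).
  rewrite mulr_suml -sumrB; apply: ideal_sum => // v _.
  by rewrite -mulrA -mulrBr; apply: (idealMl _ idJ).
have modQ n : ideal_exp I n.+1 `<=`
    [set x | exists c, Q n (x - c * e0 ^+ n.+1)].
  elim: n => [|n IHn]; apply: ideal_mul_min => [|y z Iy Iz] /=;
    try exact: ideal_add_principal; have [b Jb] := I_e0 y Iy.
    exists (b * z); rewrite expr1 mulrAC -mulrBl.
    exact: ideal_mul_mem.
  have [c Qc] := IHn z Iz; exists (b * c); rewrite exprS subrMM.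
  apply: (idealD (idQ _)) => //; first exact: ideal_mul_mem.
  by apply: (idealMl _ (idQ _)) => //; apply: Qe.
have hE : h = h.-1.+1 by lia.
have Qe0 : Q h.-1 (e0 ^+ h).
  (* Each class of edges is a perfect matching of the cycle, so both products equal the product of
     all cycle variables. *)
  have prodE : \prod_(j < h) ledge (cyc j.*2) = \prod_(j < h) ledge (cyc j.*2.+1).
    have -> : \prod_(j < h) ledge (cyc j.*2) =
        \prod_(j < h) local_of 'X_(cyc j.*2) *
        \prod_(j < h) local_of 'X_(cyc j.*2.+1).
      rewrite -big_split; apply: eq_bigr => j _.
      by rewrite /= /ledge /edge sigma_cyc rmorphM.
    rewrite mulrC.
    rewrite -(prod_cyclic_shift (F := fun j => local_of 'X_(cyc j.*2) : R)).
      rewrite -big_split; apply: eq_bigr => j _.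
      by rewrite /= /ledge /edge sigma_cyc rmorphM.
    by rewrite -[h.*2]add0n cycDd.
  have := prodQ (fun j => cyc j.*2.+1) h.-1; have := prodQ (fun j => cyc j.*2) h.-1.
  rewrite -hE -[\prod_(j < h) a (cyc j.*2)]/(alt_prod a 0) aP0.
  rewrite -[\prod_(j < h) a (cyc j.*2.+1)]/(alt_prod a 1) aP1.
  rewrite rmorph1 rmorph0 mul1r mul0r subr0 -prodE => Q1 Q2.
  by have := idealB (idQ _) Q2 Q1; rewrite subKr.
split=> //; exists h.-1; apply/seteqP; split=> x.
  move=> /modQ[c]; rewrite -hE => /ideal_eqmod; apply=> //.
  exact: (idealMl _ (idQ _)).
apply: ideal_mul_min; first exact: ideal_exp_ideal.
by move=> y z Jy Iz; apply: ideal_mul_mem => //; apply: JI.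
Qed.

End ProperReduction.

(** * Annihilators containing a plane *)

Lemma coef_prod_linear (b c : nat -> k) n :
  (\prod_(j < n) ((b j)%:P + (c j)%:P * 'X))`_n = \prod_(j < n) c j.
Proof.
have sz l : (size (\prod_(j < l) ((b j)%:P + (c j)%:P * 'X))%R <= l.+1)%N.
  elim: l => [|l IHl]; first by rewrite big_ord0 size_poly1.
  rewrite big_ord_recr /=; apply: leq_trans (size_polyMleq _ _) _.
  have : (size ((b l)%:P + (c l)%:P * 'X)%R <= 2)%N.
    rewrite addrC size_MXaddC; case: ifP => // _.
    by rewrite ltnS size_polyC_leq1.
  move=> s2; rewrite -subn1 leq_subLR add1n.
  by apply: leq_trans (leq_add IHl s2) _; rewrite addn2.
elim: n => [|n IHn]; first by rewrite !big_ord0 coef1.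
rewrite !big_ord_recr /= mulrDr coefD mulrA coefMX /= !coefMC IHn.
(* The first [n] factors have total degree at most [n], so the constant term of the last one does
   not reach the top coefficient. *)
by rewrite [X in X * _]nth_default ?sz // mul0r add0r.
Qed.

(** On the line [b + t c] the difference of the alternating products is a polynomial [g] in [t]. A
    nonconstant [g] has a root in an extension; for a constant [g] the point at infinity [c]
    works. *)
Lemma alt_prod_vanishes_on_line (b c : 'I_s -> k) :
    (exists v, c v != 0) -> (forall t, exists v, b v != t * c v) ->
  exists (K : fieldType) (iota : {rmorphism k -> K}) (a : 'I_s -> K),
    [/\ exists v, a v != 0, alt_prod a 0 = alt_prod a 1 &
    forall r : 'I_s -> k, \sum_v r v * b v = 0 -> \sum_v r v * c v = 0 ->
      \sum_v iota (r v) * a v = 0].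
Proof.
move=> [v0 cv0] nbc.
pose l v : {poly k} := (b v)%:P + (c v)%:P * 'X.
pose g := alt_prod l 0 - alt_prod l 1.
have [g1|g1] := leqP (size g) 1; last first.
  have [K [iota [z gz]]] := extension_root g1.
  pose a v := iota (b v) + iota (c v) * z.
  exists K, iota, a; split.
  - apply: contrapT => a0.
    have {}a0 v : a v = 0.
      by apply/eqP; apply: contrapT => /negP av; apply: a0; exists v.
    have icv0 : iota (c v0) != 0 by rewrite fmorph_eq0.
    (* If [b + z c] were zero, [z] would come from [k] and [b] would be a multiple of [c]. *)
    have zE : z = iota (- b v0 / c v0).
      rewrite fmorph_div rmorphN; apply: (mulfI icv0); rewrite mulrCA divff // mulr1.
      by apply/eqP; rewrite -addr_eq0 addrC; apply/eqP/a0.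
    have [v] := nbc (b v0 / c v0); apply/negP; rewrite negbK.
    have := a0 v; rewrite /a zE -rmorphM -rmorphD => /eqP; rewrite fmorph_eq0.
    by rewrite mulNr mulrN subr_eq0 mulrC.
  - have hE i : (map_poly iota (alt_prod l i)).[z] = alt_prod a i.
      rewrite /alt_prod rmorph_prod horner_prod; apply: eq_bigr => j _.
      by rewrite /l rmorphD rmorphM /= !map_polyC map_polyX hornerD hornerMX !hornerC.
    by move: gz; rewrite /root rmorphB hornerD hornerN !hE subr_eq0 => /eqP.
  - move=> r rb rc.
    transitivity (iota (\sum_v r v * b v) + iota (\sum_v r v * c v) * z).
      rewrite !rmorph_sum mulr_suml -big_split; apply: eq_bigr => v _ /=.
      by rewrite !rmorphM /a mulrDr mulrA.
    by rewrite rb rc rmorph0 mul0r addr0.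
exists k, idfun, c; split=> //; first by exists v0.
(* The coefficient of [t^h] in [g] is the difference of the alternating products of [c]. *)
have gh : g`_h = 0 by rewrite nth_default // (leq_trans g1) // ltnW.
move: gh; rewrite /g coefB /alt_prod /l.
rewrite (coef_prod_linear (fun j => b (cyc (0 + j.*2)))
  (fun j => c (cyc (0 + j.*2)))).
rewrite (coef_prod_linear (fun j => b (cyc (1 + j.*2)))
  (fun j => c (cyc (1 + j.*2)))).
by move/eqP; rewrite subr_eq0 => /eqP.
Qed.

Lemma ledge_not_minimal_reduction : ~ minimal_reduction ledge_ideal ledge_ideal.
Proof.
move=> [_ minI]; pose a (v : 'I_s) : k := ((v < h.*2)%N && ~~ odd v)%:R.
have aE i : a (cyc i) = (~~ odd i)%:R.
  rewrite /a /= ltn_mod double_gt0 ltnW //=; congr (nat_of_bool (~~ _))%:R.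
  by rewrite [in RHS](divn_eq i h.*2) oddD oddM odd_double andbF.
have P0 : alt_prod a 0 = 1.
  by rewrite /alt_prod big1 // => j _; rewrite aE add0n odd_double.
have P1 : alt_prod a 1 = 0.
  apply/eqP/prodf_eq0; exists (Ordinal (ltnW h_gt1)) => //.
  by rewrite aE.
have a0 : a (cyc 0) = 1 by rewrite aE.
apply: (hyperplane_ideal_proper a0).
rewrite (minI _ (hyperplane_ideal_reduction P0 P1)); first exact: ledge_mem.
by case: (hyperplane_ideal_reduction P0 P1).
Qed.

(** * The colon ideal of a minimal reduction *)

Lemma ledge_colon_minimal_reduction (J : set R) :
  minimal_reduction ledge_ideal J -> ideal_colon J ledge_ideal = m.
Proof.
move=> minJ; have [redJ _] := minJ; have [idJ JI _] := redJ.
have idm := local_max_ideal k s.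
have nIJ : ~ ledge_ideal `<=` J.
  move=> IJ; apply: ledge_not_minimal_reduction.
  by have JE : J = ledge_ideal; [apply/seteqP | rewrite JE in minJ].
have nledge : ~ forall v, J (ledge v).
  by move=> Je; apply: nIJ; apply: ideal_gen_min => // _ [v ->].
apply/seteqP; split=> [x xJ|].
  apply: contrapT => /local_max_unit[y xy]; apply: nIJ => z Iz.
  by apply: (ideal_unit idJ xy); apply: xJ.
suff Jxe : forall u v, J (local_of 'X_u * ledge v).
  apply: ideal_gen_min => [|_ [u ->] z /ideal_gen_fin[c ->]]; last first.
    rewrite mulr_sumr; apply: (ideal_sum _ idJ) => v _.
    by rewrite mulrCA; apply: (idealMl _ idJ).
  split=> [z Iz|x y xJ yJ z Iz|b x xJ z Iz] /=.
  - by rewrite mul0r; apply: (ideal0 idJ).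
  - by rewrite mulrDl; apply: (idealD idJ); [apply: xJ | apply: yJ].
  - by rewrite -mulrA; apply: (idealMl _ idJ); apply: xJ.
pose lin (c : 'rV[k]_s) : R := \sum_v local_const s (c 0 v) * ledge v.
pose W : set 'rV[k]_s := [set c | sum_mul_ideal m J ledge (lin c)].
have idS : is_ideal (sum_mul_ideal m J ledge) by apply: sum_mul_ideal_ideal.
have [|c c' Wc Wc'|b c Wc|M WM] := @closed_row_space k s W.
- rewrite /W /= /lin big1 => [|v _]; first exact: (ideal0 idS).
  by rewrite mxE rmorph0 mul0r.
- rewrite /W /=; have -> : lin (c + c') = lin c + lin c'.
    by rewrite -big_split; apply: eq_bigr => v _; rewrite mxE rmorphD mulrDl.
  exact: (idealD idS).
- rewrite /W /=; have -> : lin (b *: c) = local_const s b * lin c.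
    by rewrite mulr_sumr; apply: eq_bigr => v _; rewrite mxE rmorphM mulrA.
  exact: (idealMl _ idS).
(* The columns of [Q] are annihilators of [W] and cut it out. The cases below are: all zero, two
   independent ones, or all proportional to one column [a]. *)
pose Q := cokermx M.
have WQ (r : 'rV_s) : W r <-> forall j, \sum_v r 0 v * Q v j = 0.
  rewrite WM submxE; split=> [/eqP rQ j|rQ].
    by have /matrixP/(_ 0 j) := rQ; rewrite !mxE.
  by apply/eqP/rowP => j; rewrite !mxE; apply: rQ.
have lin_row r : sum_mul_ideal m J ledge (\sum_v local_const s (r v) * ledge v) ->
    W (\row_v r v).
  by rewrite /W /= /lin; under [in X in _ -> X]eq_bigr do rewrite mxE.
have lin_delta v : lin (delta_mx 0 v) = ledge v.
  rewrite /lin (bigD1 v) //= mxE !eqxx rmorph1 mul1r big1 ?addr0 // => w wv.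
  by rewrite mxE (negPf wv) andbF rmorph0 mul0r.
have [j [v0 Qv0]] : exists j v, Q v j != 0.
  apply: contrapT => Q0; apply: nledge.
  apply: (nakayama idm (@local_max_unitB k s) idJ) => v.
  rewrite -lin_delta -/(W _); apply/WQ => j.
  apply: big1 => w _; suff -> : Q w j = 0 by rewrite mulr0.
  by apply/eqP; apply: contrapT => /negP Qw; apply: Q0; exists j, w.
pose a w := Q w j.
have [line|] := pselect (forall j', exists t, forall w, Q w j' = t * a w);
  last first.
  move=> nline; exfalso.
  have [j' nj'] : exists j', forall t, exists w, Q w j' != t * a w.
    apply: contrapT => nj; apply: nline => j'; apply: contrapT => nt.
    apply: nj; exists j' => t; apply: contrapT => nw; apply: nt; exists t => w.
    by apply/eqP; apply: contrapT => /negP Qw; apply: nw; exists w.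
  have [|K [iota [b [[w bw] bP bW]]]] := alt_prod_vanishes_on_line _ nj'.
    by exists v0.
  apply: (cycle_relation_not_reduction bw bP _ redJ) => r /lin_row/WQ rW.
  have rQ i : \sum_w r w * Q w i = 0.
    by rewrite -[RHS](rW i); apply: eq_bigr => u _; rewrite mxE.
  by apply: bW; apply: rQ.
have aW (r : 'I_s -> k) : \sum_w r w * a w = 0 -> W (\row_w r w).
  move=> ra; apply/WQ => j'; have [t tE] := line j'.
  transitivity (t * \sum_w r w * a w); last by rewrite ra mulr0.
  by rewrite mulr_sumr; apply: eq_bigr => w _; rewrite mxE tE mulrCA.
have [aP|aP] := eqVneq (alt_prod a 0) (alt_prod a 1).
  exfalso.
  apply: (cycle_relation_not_reduction (iota := idfun) (a := a) Qv0 aP _ redJ).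
  move=> r /lin_row/WQ/(_ j) rW; rewrite -[RHS]rW.
  by apply: eq_bigr => w _; rewrite mxE.
apply: (hyperplane_socle idJ aP) => u v.
(* The obvious vector orthogonal to [a] supported on [u] and [v]. *)
pose r w := a u * (w == v)%:R - a v * (w == u)%:R.
have := aW r; rewrite /W /=.
have -> : lin (\row_w r w) =
    local_const s (a u) * ledge v - local_const s (a v) * ledge u.
  rewrite /lin -[in RHS](lin_delta v) -[in RHS](lin_delta u) /lin !mulr_sumr -sumrB.
  apply: eq_bigr => w _; rewrite !mxE !eqxx /= /r rmorphB !rmorphM mulrBl.
  by rewrite -!mulrA.
apply; rewrite (eq_bigr (fun w =>
  a u * ((w == v)%:R * a w) - a v * ((w == u)%:R * a w))).
  rewrite sumrB -!mulr_sumr.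
  have pick w : \sum_i (i == w)%:R * a i = a w.
    rewrite (bigD1 w) //= eqxx mul1r big1 ?addr0 // => i /negPf ->.
    by rewrite mul0r.
  by rewrite !pick mulrC subrr.
by move=> w _; rewrite /r mulrBl !mulrA.
Qed.

End CycleWithLeaves.

(** * Recognizing the graph *)

Section UnicyclicGraph.
Local Open Scope nat_scope.
Variables (n d : nat) (e : rel 'I_n.+1).
Hypotheses (symE : ssrbool.symmetric e) (irrE : irreflexive e).
Hypotheses (d_gt2 : 2 < d) (dn : d <= n.+1).
Hypothesis conn : connected_graph e.
Hypothesis cyc_uniq : unique_cycle e [seq i : 'I_n.+1 <- enum 'I_n.+1 | i < d].
Hypothesis leafE : forall j : 'I_n.+1, d <= j -> leaf e j.

Let seg m l := [seq i : 'I_n.+1 <- enum 'I_n.+1 | m <= i < m + l].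
(** Adjacency carried over to naturals, so that cycles on consecutive vertices become statements
    about [iota]. *)
Let r : rel nat := fun i j => e (inord i) (inord j).

Lemma path_iota (q : rel nat) m l :
  reflect (forall i, m <= i < m + l -> q i i.+1) (path q m (iota m.+1 l)).
Proof.
elim: l m => [|l IHl] m /=; first by apply: ReflectT => i; lia.
apply: (iffP andP) => [[qm /IHl ql] i im|ql].
  by have [->//|mi] := eqVneq i m; apply: ql; lia.
by split; [apply: ql; lia | apply/IHl => i im; apply: ql; lia].
Qed.

Lemma val_seg m l : m + l <= n.+1 -> map val (seg m l) = iota m l.
Proof.
move=> mln; rewrite /seg.
rewrite -(filter_map val (fun i => m <= i < m + l)) val_enum_ord.
apply: (irr_sorted_eq ltn_trans ltnn).
- by apply: sorted_filter; [exact: ltn_trans | exact: iota_ltn_sorted].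
- exact: iota_ltn_sorted.
- by move=> i; rewrite mem_filter !mem_iota; lia.
Qed.

Lemma cycle_seg m l : m + l.+1 <= n.+1 ->
  reflect ((forall i, m <= i < m + l -> r i i.+1) /\ r (m + l) m)
          (cycle e (seg m l.+1)).
Proof.
move=> mln; have -> : cycle e (seg m l.+1) = cycle r (iota m l.+1).
  rewrite -val_seg // cycle_map; apply: eq_cycle => x y.
  by rewrite /= /r !inord_val.
rewrite /= rcons_path; have -> : last m (iota m.+1 l) = m + l.
  by elim: (l) (m) => [|l' IHl] m' /=; rewrite ?addn0 // IHl addnS.
by apply: (iffP andP) => -[/path_iota].
Qed.

Let segE : [seq i : 'I_n.+1 <- enum 'I_n.+1 | i < d] = seg 0 d.-1.+1.
Proof. by apply: eq_filter => i; rewrite prednK //; lia. Qed.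

Lemma cycle_adjacent : (forall i, i.+1 < d -> r i i.+1) /\ r d.-1 0.
Proof.
have [[/andP[+ _] _] _] := cyc_uniq; rewrite segE => /cycle_seg[|adj last0].
  by lia.
by split=> // i id; apply: adj; lia.
Qed.

(* A chord would cut off a shorter cycle. *)
Lemma cycle_chordless i j :
  i < j -> j < d -> r i j -> j = i.+1 \/ (i = 0 /\ j = d.-1).
Proof.
move=> ij jd rij; apply: contrapT => nadj.
have [adj _] := cycle_adjacent; have [[cycE _] uniqE] := cyc_uniq.
have gc : graph_cycle e (seg i (j - i).+1).
  split; last by rewrite -(size_map val) val_seg ?size_iota; lia.
  apply/andP; split; last by rewrite filter_uniq // enum_uniq.
  apply/cycle_seg; first by lia.
  split=> [l il|]; first by apply: adj; lia.
  by rewrite subnKC ?(ltnW ij) // /r symE.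
(* A vertex of the long cycle missed by the short one; uniqueness would put an edge at it on the
   short cycle. *)
have [x [xd xij]] : exists x : 'I_n.+1, x < d /\ ~~ (i <= x <= j).
  have [i0|i0] := posnP i; last by exists ord0; split=> /=; lia.
  by exists (inord d.-1); rewrite inordK; lia.
have : [set x; next [seq i : 'I_n.+1 <- enum 'I_n.+1 | i < d] x]%SET \in
    cycle_edges (seg i (j - i).+1).
  rewrite uniqE //; apply: imset_f.
  by rewrite mem_filter xd mem_enum.
move=> /imsetP[y yseg] /setP/(_ x).
rewrite !inE eqxx /= => /esym xy.
have : x \in seg i (j - i).+1.
  by case/orP: xy => /eqP ->; rewrite // mem_next.
by rewrite mem_filter mem_enum; lia.
Qed.

(** A neighbour off the cycle would be a leaf too; the two would form a whole component, missing
    vertex [0]. *)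
Lemma leaf_neighbor (v : 'I_n.+1) : d <= v ->
  exists2 u : 'I_n.+1, u < d & forall y, e v y = (y == u).
Proof.
move=> dv; have /eqP/cards1P[u uE] := leafE dv.
have vE y : e v y = (y == u) by move/setP/(_ y): uE; rewrite !inE.
exists u => //; rewrite ltnNge; apply/negP => du.
have /eqP/cards1P[v' v'E] := leafE du.
have uE' y : e u y = (y == v).
  have uv : e u v by rewrite symE vE.
  move/setP: v'E => v'E; have := v'E v; have := v'E y.
  by rewrite !inE uv => -> /esym/eqP->.
have cl : closed e (pred2 v u).
  apply: intro_closed; first exact: sym_connect_sym.
  by move=> x y xy /pred2P[] xE; move: xy; rewrite xE ?vE ?uE' => /eqP->;
    rewrite !inE eqxx ?orbT.
have := closed_connect cl (conn v ord0).
by rewrite !inE eqxx /= => /esym/orP[] /eqP/(congr1 val) /=; lia.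
Qed.

(** The map [sigma] of the previous section. The default of [odflt] is never reached, since a leaf
    has a neighbour. *)
Definition succ_vertex (v : 'I_n.+1) : 'I_n.+1 :=
  if v < d then inord (v.+1 %% d) else odflt v [pick y | e v y].

Lemma succ_vertex_cycle (v : 'I_n.+1) : v < d -> succ_vertex v = v.+1 %% d :> nat.
Proof.
move=> vd; rewrite /succ_vertex vd inordK //.
by apply: leq_trans dn; rewrite ltn_mod; lia.
Qed.

Lemma succ_vertex_leaf (v : 'I_n.+1) : d <= v -> succ_vertex v < d /\
  forall y, e v y = (y == succ_vertex v).
Proof.
move=> dv; have [u ud vE] := leaf_neighbor dv.
rewrite /succ_vertex [v < d]ltnNge dv /=; case: pickP => [y|/(_ u)]; rewrite vE.
  by move/eqP->.
by rewrite eqxx.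
Qed.

Lemma succ_vertex_lt v : succ_vertex v < d.
Proof.
have [vd|/succ_vertex_leaf[]//] := ltnP v d.
by rewrite succ_vertex_cycle // ltn_mod; lia.
Qed.

Lemma succ_vertex_edge v : e v (succ_vertex v).
Proof.
have [vd|/succ_vertex_leaf[_ ->]//] := ltnP v d.
have [adj adj0] := cycle_adjacent.
have [v1|v1] := ltnP v.+1 d.
  have := adj v v1; rewrite /r inord_val.
  congr (e _ _); apply: val_inj.
  by rewrite /= succ_vertex_cycle // modn_small // inordK //; lia.
have vE : v = d.-1 :> nat by lia.
move: adj0; rewrite /r -vE inord_val; congr (e _ _).
apply: val_inj; rewrite /= succ_vertex_cycle // inordK //.
have -> : v.+1 = d by lia.
by rewrite modnn.
Qed.

(** For an edge with [x <= y], either [y] is a leaf and [x] its only neighbour, or both lie on the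
    cycle, which has no chords. *)
Lemma edge_succ_vertex x y : e x y <-> y = succ_vertex x \/ x = succ_vertex y.
Proof.
split; last by case=> ->; [|rewrite symE]; apply: succ_vertex_edge.
wlog xy : x y / x <= y => [hw|exy].
  have [/hw//|/ltnW/hw {}hw] := leqP x y.
  by rewrite symE => /hw [|]; [right|left].
have [yd|dy] := ltnP y d; last first.
  by right; apply/eqP; rewrite -(succ_vertex_leaf dy).2 symE.
have xd : x < d by lia.
have {}xy : x < y.
  rewrite ltn_neqAle xy andbT; apply: contraTneq exy => /val_inj ->.
  by rewrite irrE.
have [|yE|[x0 yE]] := cycle_chordless xy yd; first by rewrite /r !inord_val.
  left; apply: val_inj; rewrite /= succ_vertex_cycle // modn_small ?yE //.
  by rewrite -yE.
right; apply: val_inj; rewrite /= succ_vertex_cycle //.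
have -> : y.+1 = d by lia.
by rewrite modnn.
Qed.

End UnicyclicGraph.

Lemma edge_ideal_ledge (k : fieldType) s (e : rel 'I_s) (sigma : 'I_s -> 'I_s) :
    (forall x y, e x y <-> y = sigma x \/ x = sigma y) ->
  edge_ideal k e = @ledge_ideal s sigma k.
Proof.
move=> eE; apply/seteqP; split; apply: ideal_gen_min; try exact: ideal_gen_ideal.
  move=> _ [x [y [/eE[]-> ->]]]; first exact: ledge_mem.
  by rewrite mulrC; apply: ledge_mem.
move=> _ [v ->]; apply: ideal_gen_sub; exists v, (sigma v).
by split; [apply/eE; left|].
Qed.

Local Close Scope ring_scope.

Theorem theorem4p4 (k : fieldType) (s d : nat) (e : rel 'I_s)
    (hk : infinite_set [set: k])
    (hG : simple_graph e)
    (hconn : connected_graph e)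
    (hd4 : 4 <= d) (hdeven : ~~ odd d) (hds : d <= s)
    (hcyc : unique_cycle e [seq i : 'I_s <- enum 'I_s | i < d])
    (hleaf : forall j : 'I_s, d <= j -> leaf e j)
    (J : set (local_poly k s))
    (hJ : minimal_reduction (edge_ideal k e) J) :
  ideal_colon J (edge_ideal k e) = local_max k s.
Proof.
case: s => [|n] in e hG hconn hds hcyc hleaf J hJ *; first by lia.
have [symE irrE] := hG.
have dE : d = d./2.*2 by rewrite even_halfK.
have d2 : 2 < d by lia.
have eE := edge_succ_vertex symE irrE d2 hds hconn hcyc hleaf.
have IE := edge_ideal_ledge k eE; rewrite IE in hJ *.
apply: (@ledge_colon_minimal_reduction n.+1 d./2) => //; rewrite -?dE //.
- by lia.
- exact: succ_vertex_lt.
- by move=> v; apply: succ_vertex_cycle.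
Qed.
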